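(* Let $X,P\in\mathbb{R}^{L\times N}$, let $\beta\ge 0$, and let $V\in\mathbb{R}^{N\times N}$ be a given diagonal matrix with positive diagonal entries. The following two updating rules are equivalent (they give the same $A\in\mathbb{R}^{N\times N}$): $$\text{(i)}\quad A=\beta\left(V+\beta X^{T}X\right)^{-1}X^{T}P,\qquad \text{(ii)}\quad A=\beta\left(XV^{-1}\right)^{T}\left[I_{L}+\beta X\left(XV^{-1}\right)^{T}\right]^{-1}P .$$ Consider the algorithm that, on input $X,V,P,\beta$, computes $A$ by rule (i) if $N\le L$, and, if $N>L$, computes $A$ by rule (ii) in the form $A=B(I_L+XB)^{-1}P$ with $B=\beta(XV^{-1})^{T}$. Then this update of $A$ has computational complexity $O(N^{2}L)$. Thus, for $N\gg L$, the complexity is reduced from the $O(N^4)$ per iteration of Nie's method (described in the context) to $O(N^2L)$.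
   Context: Complexity counts arithmetic operations on real numbers, with dense linear algebra: multiplying a $p\times q$ matrix by a $q\times r$ matrix costs $O(pqr)$, and an $m\times m$ positive-definite linear system is solved by Cholesky factorization with $O(m^3)$ operations for the factorization and $O(m^2)$ operations for the forward and backward substitution for each right-hand side. $I_L$ is the $L\times L$ identity matrix. The rules are updates (one iteration step, with $V$ fixed) for the problem $\min_{A\in\mathbb{R}^{N\times N}}\|A\|_{2,1}+\frac{\beta}{2}\mathrm{Tr}\{(XA-P)^{T}(XA-P)\}$, where $\|A\|_{2,1}=\sum_{n}\|a^{n}\|_2$, $a^n$ is the $n$-th row of $A$, and $V_{nn}=1/\sqrt{\|a^n\|_2^2+\epsilon}$ is computed from the current iterate with $\epsilon>0$ a small constant. One iteration of Nie's method computes, for every $n=1,\dots,N$, the vector $a_n=U_{nn}(U_{nn}X^TX+\gamma V')^{-1}X^Tx_n$, where $x_n$ is the $n$-th column of $X$, $\gamma>0$, $U_{nn}>0$ are given scalars, and $V'$ is a given positive diagonal $N\times N$ matrix; each of these $N\times N$ systems is solved separately by Cholesky factorization. *)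

(* Defs.v *)
From mathcomp Require Import all_boot all_order all_algebra.
From mathcomp Require Import reals.

Set Implicit Arguments.
Unset Strict Implicit.
Unset Printing Implicit Defensive.

Import Order.TTheory GRing.Theory Num.Theory.
Local Open Scope ring_scope.

(* A value together with the number of real arithmetic operations spent on
   computing it.  Only [c_add], [c_sub], [c_mul], [c_div] and [c_sqrt] count;
   copying, indexing, the constants 0 and 1 and tests on dimensions are free. *)
Record counted (T : Type) : Type := Counted { result : T; nops : nat }.

Definition ret {T : Type} (x : T) : counted T := Counted x 0.

Definition bind {T S : Type} (m : counted T) (f : T -> counted S) : counted S :=
  Counted (result (f (result m))) (nops m + nops (f (result m))).

Notation "x <-- m ; k" := (bind m (fun x => k))
  (at level 100, m at next level, k at level 200, right associativity,
   format "x  <--  m ;  '/' k").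

Definition c_add {R : rcfType} (x y : R) : counted R := Counted (x + y) 1.
Definition c_sub {R : rcfType} (x y : R) : counted R := Counted (x - y) 1.
Definition c_mul {R : rcfType} (x y : R) : counted R := Counted (x * y) 1.
Definition c_div {R : rcfType} (x y : R) : counted R := Counted (x / y) 1.
Definition c_sqrt {R : rcfType} (x : R) : counted R := Counted (Num.sqrt x) 1.

(* The accumulator starts at 0, so n additions are counted rather than n - 1. *)
Definition c_sum {R : rcfType} {n : nat} (f : 'I_n -> counted R) : counted R :=
  foldr (fun i acc => s <-- acc; x <-- f i; c_add x s) (ret 0) (enum 'I_n).

(* Independent computation of all the entries (resp. columns) of a matrix. *)
Definition c_entries {R : rcfType} {m n : nat} (f : 'I_m -> 'I_n -> counted R) :
    counted 'M[R]_(m, n) :=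
  Counted (\matrix_(i, j) result (f i j)) (\sum_i \sum_j nops (f i j))%N.

Definition c_cols {R : rcfType} {m n : nat} (f : 'I_n -> counted 'cV[R]_m) :
    counted 'M[R]_(m, n) :=
  Counted (\matrix_(i, j) result (f j) i 0) (\sum_j nops (f j))%N.

Definition c_addmx {R : rcfType} {m n : nat} (A B : 'M[R]_(m, n)) :=
  c_entries (fun i j => c_add (A i j) (B i j)).

Definition c_submx {R : rcfType} {m n : nat} (A B : 'M[R]_(m, n)) :=
  c_entries (fun i j => c_sub (A i j) (B i j)).

Definition c_scalemx {R : rcfType} {m n : nat} (a : R) (A : 'M[R]_(m, n)) :=
  c_entries (fun i j => c_mul a (A i j)).

Definition c_mulmx {R : rcfType} {p q r : nat}
    (A : 'M[R]_(p, q)) (B : 'M[R]_(q, r)) : counted 'M[R]_(p, r) :=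
  c_entries (fun i j => c_sum (fun k => c_mul (A i k) (B k j))).

(* X D^-1 for a diagonal matrix D. *)
Definition c_div_diag {R : rcfType} {m n : nat}
    (X : 'M[R]_(m, n)) (D : 'M[R]_n) :=
  c_entries (fun i j => c_div (X i j) (D j j)).

(* Outer-product form of the Cholesky factorization: for A = [a, c^T; c, A'] the
   lower triangular factor is [d, 0; l, T] with d = sqrt a, l = c / d and T the
   factor of the Schur complement A' - l l^T. *)
Fixpoint cholesky {R : rcfType} {n : nat} : 'M[R]_n -> counted 'M[R]_n :=
  match n return 'M[R]_n -> counted 'M[R]_n with
  | 0 => fun A => ret A
  | n'.+1 => fun A : 'M[R]_(1 + n') =>
      d <-- c_sqrt (ulsubmx A 0 0);
      l <-- c_entries (fun i j => c_div (dlsubmx A i j) d);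
      ll <-- c_mulmx l l^T;
      S <-- c_submx (drsubmx A) ll;
      T <-- cholesky S;
      ret (block_mx (d%:M : 'M_1) 0 l T : 'M[R]_(1 + n'))
  end.

(* Solves T y = b for lower triangular T, column by column. *)
Fixpoint forward_subst {R : rcfType} {n : nat} :
    'M[R]_n -> 'cV[R]_n -> counted 'cV[R]_n :=
  match n return 'M[R]_n -> 'cV[R]_n -> counted 'cV[R]_n with
  | 0 => fun _ b => ret b
  | n'.+1 => fun (T : 'M[R]_(1 + n')) (b : 'cV[R]_(1 + n')) =>
      y0 <-- c_div (usubmx b 0 0) (ulsubmx T 0 0);
      c <-- c_scalemx y0 (dlsubmx T);
      b' <-- c_submx (dsubmx b) c;
      y' <-- forward_subst (drsubmx T) b';
      ret (col_mx (y0%:M : 'M_1) y' : 'cV[R]_(1 + n'))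
  end.

(* Solves T^T x = y for lower triangular T. *)
Fixpoint backward_subst {R : rcfType} {n : nat} :
    'M[R]_n -> 'cV[R]_n -> counted 'cV[R]_n :=
  match n return 'M[R]_n -> 'cV[R]_n -> counted 'cV[R]_n with
  | 0 => fun _ y => ret y
  | n'.+1 => fun (T : 'M[R]_(1 + n')) (y : 'cV[R]_(1 + n')) =>
      x' <-- backward_subst (drsubmx T) (dsubmx y);
      s <-- c_sum (fun k => c_mul (dlsubmx T k 0) (x' k 0));
      t <-- c_sub (usubmx y 0 0) s;
      x0 <-- c_div t (ulsubmx T 0 0);
      ret (col_mx (x0%:M : 'M_1) x' : 'cV[R]_(1 + n'))
  end.

(* One factorization, then two substitutions for each column of B. *)
Definition cholesky_solve {R : rcfType} {m r : nat}
    (A : 'M[R]_m) (B : 'M[R]_(m, r)) : counted 'M[R]_(m, r) :=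
  T <-- cholesky A;
  c_cols (fun j => y <-- forward_subst T (col j B); backward_subst T y).

Definition pos_diag_mx {R : rcfType} {n : nat} (D : 'M[R]_n) : Prop :=
  is_diag_mx D /\ forall i, 0 < D i i.

Definition sys_i {R : rcfType} {L N : nat}
    (X : 'M[R]_(L, N)) (V : 'M[R]_N) (beta : R) : 'M[R]_N :=
  V + beta *: (X^T *m X).

Definition rule_i {R : rcfType} {L N : nat}
    (X P : 'M[R]_(L, N)) (V : 'M[R]_N) (beta : R) : 'M[R]_N :=
  beta *: (invmx (sys_i X V beta) *m X^T *m P).

Definition sys_ii {R : rcfType} {L N : nat}
    (X : 'M[R]_(L, N)) (V : 'M[R]_N) (beta : R) : 'M[R]_L :=
  1%:M + beta *: (X *m (X *m invmx V)^T).

Definition rule_ii {R : rcfType} {L N : nat}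
    (X P : 'M[R]_(L, N)) (V : 'M[R]_N) (beta : R) : 'M[R]_N :=
  beta *: ((X *m invmx V)^T *m invmx (sys_ii X V beta) *m P).

Definition update_i {R : rcfType} {L N : nat}
    (X P : 'M[R]_(L, N)) (V : 'M[R]_N) (beta : R) : counted 'M[R]_N :=
  G <-- c_mulmx X^T X;
  bG <-- c_scalemx beta G;
  S <-- c_addmx V bG;
  W <-- c_mulmx X^T P;
  Z <-- cholesky_solve S W;
  c_scalemx beta Z.

Definition update_ii {R : rcfType} {L N : nat}
    (X P : 'M[R]_(L, N)) (V : 'M[R]_N) (beta : R) : counted 'M[R]_N :=
  Y <-- c_div_diag X V;
  B <-- c_scalemx beta Y^T;
  XB <-- c_mulmx X B;
  S <-- c_addmx 1%:M XB;
  Z <-- cholesky_solve S P;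
  c_mulmx B Z.

Definition update {R : rcfType} {L N : nat}
    (X P : 'M[R]_(L, N)) (V : 'M[R]_N) (beta : R) : counted 'M[R]_N :=
  if (N <= L)%N then update_i X P V beta else update_ii X P V beta.

Definition nie_vec {R : rcfType} {L N : nat} (X : 'M[R]_(L, N))
    (U : 'I_N -> R) (V' : 'M[R]_N) (gamma : R) (n : 'I_N) : 'cV[R]_N :=
  U n *: (invmx (U n *: (X^T *m X) + gamma *: V') *m X^T *m col n X).

(* The matrix X^T X and gamma V' are shared by all n; the N systems are
   assembled and factored one by one. *)
Definition nie_iteration {R : rcfType} {L N : nat} (X : 'M[R]_(L, N))
    (U : 'I_N -> R) (V' : 'M[R]_N) (gamma : R) : counted 'M[R]_N :=
  G <-- c_mulmx X^T X;
  gV <-- c_scalemx gamma V';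
  c_cols (fun n =>
    uG <-- c_scalemx (U n) G;
    S <-- c_addmx uG gV;
    w <-- c_mulmx X^T (col n X);
    z <-- cholesky_solve S w;
    c_scalemx (U n) z).

(* Main.v *)
(** V + beta X^T X and I + beta X V^-1 X^T are positive definite, and the
    push-through identity (V + beta X^T X) V^-1 X^T = X^T (I + beta X V^-1 X^T)
    turns one rule into the other.  Cholesky factorization succeeds because
    Schur complements inherit positive definiteness.  All operation counts are
    data independent: n^3 - n^2 + n for a factorization and 2 n^2 + n for a pair
    of substitutions, so each of the N systems in Nie's method costs at least
    N^3 operations. *)
Require Import Defs.
From mathcomp Require Import all_boot all_order all_algebra.
From mathcomp Require Import reals.
From mathcomp Require Import zify ring.

Set Implicit Arguments.
Unset Strict Implicit.
Unset Printing Implicit Defensive.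

Import Order.TTheory GRing.Theory Num.Theory.
Local Open Scope ring_scope.

(** * Values and exact operation counts of the counted primitives *)

Section CountedOperations.
Context {R : rcfType}.

Lemma nops_bind T S (m : counted T) (f : T -> counted S) :
  nops (bind m f) = (nops m + nops (f (result m)))%N.
Proof. by []. Qed.

Lemma result_c_sum n (f : 'I_n -> counted R) :
  result (c_sum f) = \sum_i result (f i).
Proof.
rewrite /c_sum -[RHS]big_enum /=; elim: (enum 'I_n) => [|i s IHs] /=.
  by rewrite big_nil.
by rewrite big_cons IHs addrC.
Qed.

(** Each term costs one product and one addition, the first being added to the initial 0. *)
Lemma nops_c_sum_mul n (f g : 'I_n -> R) :
  nops (c_sum (fun k => c_mul (f k) (g k))) = (2 * n)%N.
Proof.
rewrite /c_sum -[in RHS](size_enum_ord n).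
by elim: (enum 'I_n) => [|i s IHs] //=; rewrite IHs mulnS addnC.
Qed.

Lemma nops_c_entries_const m n (f : 'I_m -> 'I_n -> counted R) c :
  (forall i j, nops (f i j) = c) -> nops (c_entries f) = (m * n * c)%N.
Proof.
move=> fc /=; under eq_bigr do under eq_bigr do rewrite fc.
by rewrite !sum_nat_const !card_ord mulnA.
Qed.

Lemma nops_c_cols_const m n (f : 'I_n -> counted 'cV[R]_m) c :
  (forall j, nops (f j) = c) -> nops (c_cols f) = (n * c)%N.
Proof.
by move=> fc /=; under eq_bigr do rewrite fc; rewrite sum_nat_const card_ord.
Qed.

Lemma col_result_c_cols m n (f : 'I_n -> counted 'cV[R]_m) j :
  col j (result (c_cols f)) = result (f j).
Proof. by apply/colP => i; rewrite !mxE. Qed.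

Lemma result_c_addmx m n (A B : 'M[R]_(m, n)) : result (c_addmx A B) = A + B.
Proof. by apply/matrixP => i j; rewrite !mxE. Qed.

Lemma nops_c_addmx m n (A B : 'M[R]_(m, n)) : nops (c_addmx A B) = (m * n)%N.
Proof. by rewrite (@nops_c_entries_const _ _ _ 1) ?muln1. Qed.

Lemma result_c_submx m n (A B : 'M[R]_(m, n)) : result (c_submx A B) = A - B.
Proof. by apply/matrixP => i j; rewrite !mxE. Qed.

Lemma nops_c_submx m n (A B : 'M[R]_(m, n)) : nops (c_submx A B) = (m * n)%N.
Proof. by rewrite (@nops_c_entries_const _ _ _ 1) ?muln1. Qed.

Lemma result_c_scalemx m n a (A : 'M[R]_(m, n)) :
  result (c_scalemx a A) = a *: A.
Proof. by apply/matrixP => i j; rewrite !mxE. Qed.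

Lemma nops_c_scalemx m n a (A : 'M[R]_(m, n)) :
  nops (c_scalemx a A) = (m * n)%N.
Proof. by rewrite (@nops_c_entries_const _ _ _ 1) ?muln1. Qed.

Lemma result_c_mulmx p q r (A : 'M[R]_(p, q)) (B : 'M[R]_(q, r)) :
  result (c_mulmx A B) = A *m B.
Proof. by apply/matrixP => i j; rewrite !mxE result_c_sum. Qed.

Lemma nops_c_mulmx p q r (A : 'M[R]_(p, q)) (B : 'M[R]_(q, r)) :
  nops (c_mulmx A B) = (p * r * (2 * q))%N.
Proof. by apply: nops_c_entries_const => i j; apply: nops_c_sum_mul. Qed.

Lemma nops_c_div_diag m n (X : 'M[R]_(m, n)) D :
  nops (c_div_diag X D) = (m * n)%N.
Proof. by rewrite (@nops_c_entries_const _ _ _ 1) ?muln1. Qed.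

(** Unfolds one elimination step into plain matrix algebra. Its cost is one root, [n] divisions,
    [2 n^2] for the outer product and [n^2] subtractions. *)
Lemma choleskyS n (A : 'M[R]_(1 + n)) :
  let d := Num.sqrt (ulsubmx A 0 0) in
  let l := d^-1 *: dlsubmx A in
  let T := cholesky (drsubmx A - l *m l^T) in
  cholesky (A : 'M_n.+1) =
    Counted (block_mx d%:M 0 l (result T)) (1 + n + 3 * n ^ 2 + nops T).
Proof.
move=> d l T.
pose l' := result (c_entries (fun i j => c_div (dlsubmx A i j) d)).
have l'E : l' = l by apply/matrixP => i j; rewrite !mxE mulrC.
pose S := result (c_submx (drsubmx A) (result (c_mulmx l' l'^T))).
have SE : S = drsubmx A - l *m l^T.
  by rewrite /S result_c_submx result_c_mulmx l'E.
(* The chain of [bind]s is convertible to this explicit record, on which the lemmas about single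
   operations can be rewritten. *)
rewrite /T -SE -l'E; transitivity (Counted (block_mx d%:M 0 l' (result (cholesky S)))
  (1 + (nops (c_entries (fun i j => c_div (dlsubmx A i j) d))
   + (nops (c_mulmx l' l'^T) + (nops (c_submx (drsubmx A)
       (result (c_mulmx l' l'^T))) + (nops (cholesky S) + 0)))))%N); first by [].
congr Counted; rewrite (@nops_c_entries_const _ _ _ 1) // nops_c_mulmx.
by rewrite nops_c_submx; move: (nops _) => t; lia.
Qed.

Lemma forward_substS n (T : 'M[R]_(1 + n)) (b : 'cV[R]_(1 + n)) :
  let y0 := usubmx b 0 0 / ulsubmx T 0 0 in
  let y := forward_subst (drsubmx T) (dsubmx b - y0 *: dlsubmx T) in
  forward_subst (T : 'M_n.+1) b =
    Counted (col_mx y0%:M (result y)) (1 + 2 * n + nops y).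
Proof.
move=> y0 y.
pose c := c_scalemx y0 (dlsubmx T).
pose b' := c_submx (dsubmx b) (result c).
have b'E : result b' = dsubmx b - y0 *: dlsubmx T.
  by rewrite result_c_submx result_c_scalemx.
rewrite /y -b'E.
transitivity (Counted (col_mx y0%:M (result (forward_subst (drsubmx T)
  (result b')))) (1 + (nops c + (nops b' +
  (nops (forward_subst (drsubmx T) (result b')) + 0))))%N); first by [].
congr Counted; rewrite nops_c_scalemx nops_c_submx.
by move: (nops _) => t; lia.
Qed.

Lemma backward_substS n (T : 'M[R]_(1 + n)) (y : 'cV[R]_(1 + n)) :
  let x := backward_subst (drsubmx T) (dsubmx y) in
  let x0 := (usubmx y 0 0 - ((dlsubmx T)^T *m result x) 0 0)
              / ulsubmx T 0 0 in
  backward_subst (T : 'M_n.+1) y =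
    Counted (col_mx x0%:M (result x)) (2 + 2 * n + nops x).
Proof.
move=> x x0.
pose s := c_sum (fun k => c_mul (dlsubmx T k 0) (result x k 0)).
have sE : result s = ((dlsubmx T)^T *m result x) 0 0.
  by rewrite result_c_sum mxE; apply: eq_bigr => i _; rewrite !mxE.
rewrite /x0 -sE; transitivity (Counted (col_mx
  ((usubmx y 0 0 - result s) / ulsubmx T 0 0)%:M (result x))
  (nops x + (nops s + (1 + (1 + 0))))%N); first by [].
congr Counted; rewrite nops_c_sum_mul.
by move: (nops _) => t; lia.
Qed.

(** The term [n ^ 2] stands on the left to avoid truncated subtraction. The step adds
    [3 n^2 + n + 1], the increment of [n^3 - n^2 + n]. *)
Lemma nops_cholesky n (A : 'M[R]_n) :
  (nops (cholesky A) + n ^ 2 = n ^ 3 + n)%N.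
Proof.
elim: n A => [|n IHn] A //; rewrite choleskyS /=.
(* Generalizing the cost of the Schur complement leaves a purely arithmetic goal. *)
by set S := drsubmx _ - _; move: (nops _) (IHn S) => t; lia.
Qed.

Lemma nops_forward_subst n (T : 'M[R]_n) b :
  nops (forward_subst T b) = (n ^ 2)%N.
Proof.
by elim: n T b => [|n IHn] T b //; rewrite forward_substS /= IHn; lia.
Qed.

Lemma nops_backward_subst n (T : 'M[R]_n) y :
  nops (backward_subst T y) = (n ^ 2 + n)%N.
Proof.
by elim: n T y => [|n IHn] T y //; rewrite backward_substS /= IHn; lia.
Qed.

Lemma nops_cholesky_solve m r (A : 'M[R]_m) (B : 'M[R]_(m, r)) :
  (nops (cholesky_solve A B) + m ^ 2 = m ^ 3 + m + r * (2 * m ^ 2 + m))%N.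
Proof.
rewrite nops_bind (@nops_c_cols_const _ _ _ (2 * m ^ 2 + m)).
  by rewrite addnAC nops_cholesky.
by move=> j; rewrite nops_bind nops_forward_subst nops_backward_subst; lia.
Qed.

End CountedOperations.

(** * Positive definite matrices and the equivalence of the two rules *)

Section PositiveDefinite.
Context {R : rcfType}.

Definition posdefmx n (A : 'M[R]_n) : Prop :=
  A^T = A /\ forall u : 'rV_n, u != 0 -> 0 < (u *m A *m u^T) 0 0.

(** A nonzero [v] with [v *m A = 0] would make the form vanish at [v]. *)
Lemma posdefmx_unit n (A : 'M[R]_n) : posdefmx A -> A \in unitmx.
Proof.
case=> _ Apos; rewrite -row_free_unit; apply/inj_row_free => v vA0.
have [//|/Apos] := eqVneq v 0.
by rewrite vA0 mul0mx mxE ltxx.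
Qed.

Lemma posdefmx_form_ge0 n (A : 'M[R]_n) (u : 'rV_n) :
  posdefmx A -> 0 <= (u *m A *m u^T) 0 0.
Proof.
case=> _ Apos; have [->|/Apos/ltW //] := eqVneq u 0.
by rewrite !mul0mx mxE.
Qed.

Lemma mul_row_tr_ge0 n (u : 'rV[R]_n) : 0 <= (u *m u^T) 0 0.
Proof. by rewrite mxE sumr_ge0 // => i _; rewrite mxE -expr2 sqr_ge0. Qed.

Lemma pos_diag_posdef n (D : 'M[R]_n) : pos_diag_mx D -> posdefmx D.
Proof.
case=> /is_diag_mxP Ddiag Dpos; split=> [|u u_neq0].
  apply/matrixP => i j; rewrite mxE; have [->//|neq_ij] := eqVneq i j.
  by rewrite !Ddiag // eq_sym.
have formE : (u *m D *m u^T) 0 0 = \sum_i u 0 i ^+ 2 * D i i.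
  rewrite mxE; apply: eq_bigr => i _; rewrite !mxE (bigD1 i) //=.
  by rewrite big1 => [|k neq_ki]; [ring | rewrite Ddiag ?mulr0].
(* A nonzero coordinate contributes a strictly positive term to a sum of nonnegative ones. *)
have [i ui_neq0] : exists i, u 0 i != 0 by apply/rV0Pn.
rewrite formE (bigD1 i) //= ltr_wpDr ?sumr_ge0 //.
  by move=> k _; rewrite mulr_ge0 ?sqr_ge0 ?ltW.
by rewrite mulr_gt0 // lt_def sqrf_eq0 ui_neq0 sqr_ge0.
Qed.

Lemma posdefmx1 n : posdefmx (1%:M : 'M[R]_n).
Proof.
apply: pos_diag_posdef; split=> [|i]; first exact: scalar_mx_is_diag.
by rewrite mxE eqxx ltr01.
Qed.

Lemma posdefmxZ n a (A : 'M[R]_n) : 0 < a -> posdefmx A -> posdefmx (a *: A).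
Proof.
move=> a_gt0 [Asym Apos]; split=> [|u /Apos uAu_gt0].
  by rewrite linearZ /= Asym.
by rewrite -scalemxAr -scalemxAl mxE mulr_gt0.
Qed.

(** Common pattern of [sys_i], [sys_ii] and the systems in Nie's method: a definite matrix plus a
    nonnegative multiple of a semidefinite one. *)
Lemma posdefmxDZ n a (A B : 'M[R]_n) : posdefmx A -> 0 <= a ->
  B^T = B -> (forall u : 'rV_n, 0 <= (u *m B *m u^T) 0 0) ->
  posdefmx (A + a *: B).
Proof.
move=> [Asym Apos] a_ge0 Bsym Bge0; split=> [|u /Apos uAu_gt0].
  by rewrite linearD linearZ /= Asym Bsym.
rewrite mulmxDr mulmxDl -scalemxAr -scalemxAl mxE ltr_wpDr //.
by rewrite mxE mulr_ge0.
Qed.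

Lemma trmx_gram m n (X : 'M[R]_(m, n)) : (X^T *m X)^T = X^T *m X.
Proof. by rewrite trmx_mul trmxK. Qed.

Lemma gram_form_ge0 m n (X : 'M[R]_(m, n)) (u : 'rV_n) :
  0 <= (u *m (X^T *m X) *m u^T) 0 0.
Proof.
(* The form is the squared norm of [u *m X^T]. *)
rewrite mulmxA -mulmxA -[X *m _]trmxK trmx_mul trmxK.
exact: mul_row_tr_ge0.
Qed.

Lemma trmx_invmx_sym n (A : 'M[R]_n) : A^T = A -> (invmx A)^T = invmx A.
Proof. by move=> Asym; rewrite trmx_inv Asym. Qed.

(** The form of [X V^-1 X^T] at [u] is the form of [V] at [u X V^-1]. *)
Lemma form_invmx_ge0 m n (X : 'M[R]_(m, n)) V (u : 'rV_m) : posdefmx V ->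
  0 <= (u *m (X *m (X *m invmx V)^T) *m u^T) 0 0.
Proof.
move=> Vpd; have Vunit := posdefmx_unit Vpd; have [Vsym _] := Vpd.
have := posdefmx_form_ge0 (u *m X *m invmx V) Vpd.
by rewrite !trmx_mul !trmx_invmx_sym // !mulmxA mulmxKV.
Qed.

Lemma posdef_sys_i L N (X : 'M[R]_(L, N)) V (beta : R) :
  0 <= beta -> posdefmx V -> posdefmx (sys_i X V beta).
Proof.
move=> beta_ge0 Vpd; apply: posdefmxDZ => //; first exact: trmx_gram.
exact: gram_form_ge0.
Qed.

Lemma posdef_sys_ii L N (X : 'M[R]_(L, N)) V (beta : R) :
  0 <= beta -> posdefmx V -> posdefmx (sys_ii X V beta).
Proof.
move=> beta_ge0 Vpd; apply: posdefmxDZ => //; first exact: posdefmx1.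
  by case: Vpd => Vsym _; rewrite trmx_mul trmxK trmx_mul trmx_invmx_sym // mulmxA.
by move=> u; apply: form_invmx_ge0.
Qed.

(* [sys_i *m V^-1 *m X^T = X^T *m sys_ii] *)
Lemma rule_i_ii L N (X P : 'M[R]_(L, N)) V (beta : R) :
  0 <= beta -> posdefmx V -> rule_i X P V beta = rule_ii X P V beta.
Proof.
move=> beta_ge0 Vpd; congr (_ *: (_ *m P)).
have Vunit := posdefmx_unit Vpd.
have Si_unit := posdefmx_unit (posdef_sys_i X beta_ge0 Vpd).
have Sii_unit := posdefmx_unit (posdef_sys_ii X beta_ge0 Vpd).
(* With both inverses cleared, the two sides expand to [X^T + beta X^T X V^-1 X^T]. *)
apply: (canRL (mulmxK Sii_unit)); rewrite -mulmxA; apply: (canLR (mulKmx Si_unit)).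
case: Vpd => Vsym _.
rewrite trmx_mul trmx_invmx_sym // /sys_i /sys_ii trmx_mul trmx_invmx_sym //.
rewrite mulmxDl mulmxDr mulmx1 mulKVmx // -scalemxAl -scalemxAr.
by rewrite !mulmxA.
Qed.

(* The Schur form at [u] is the form of the block matrix at
   [(- a^-1 *: (u *m c), u)]. *)
Lemma posdefmx_schur n (a : R) (c : 'cV_n) (A : 'M_n) :
  posdefmx (block_mx a%:M c^T c A) ->
  0 < a /\ posdefmx (A - a^-1 *: (c *m c^T)).
Proof.
move=> [Msym Mpos].
have a_gt0 : 0 < a.
  (* The form at the first unit vector is the pivot [a]. *)
  have /Mpos : row_mx (1%:M : 'M[R]_1) (0 : 'rV_n) != 0.
    apply/eqP => /matrixP/(_ 0 (lshift n 0)); rewrite row_mxEl !mxE.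
    by move/eqP; rewrite oner_eq0.
  rewrite mul_row_block tr_row_mx mul_row_col trmx0 mulmx0 addr0.
  by rewrite trmx1 mulmx1 mul1mx mul0mx addr0 mxE.
split=> //; move: Msym; rewrite tr_block_mx => /eq_block_mx[_ _ _ Asym].
split=> [|u u_neq0].
  by rewrite linearB linearZ /= trmx_mul trmxK Asym.
pose v := - a^-1 *: (u *m c).
have /Mpos : row_mx v u != 0.
  by rewrite row_mx_eq0 negb_and u_neq0 orbT.
rewrite mul_row_block tr_row_mx mul_row_col.
(* The choice of [v] annihilates the first block of [(v, u)] times the matrix, so only the second
   block meets [u^T]. *)
have -> : v *m a%:M + u *m c = 0.
  rewrite mul_mx_scalar scalerA mulrN divff ?gt_eqF // scaleN1r.
  by rewrite addNr.
rewrite mul0mx add0r /v -scalemxAl scaleNr addrC -mulmxA scalemxAr -mulmxBr.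
by [].
Qed.

End PositiveDefinite.

(** * Correctness of the factorization and of the substitutions *)

Section CholeskyCorrectness.
Context {R : rcfType}.

(** Induction through the Schur complement. Triangularity and the nonzero diagonal are carried along
    because the substitutions rely on them. *)
Lemma cholesky_correct n (A : 'M[R]_n) : posdefmx A ->
  let T := result (cholesky A) in
  [/\ T *m T^T = A, is_trig_mx T & forall i, T i i != 0].
Proof.
elim: n A => [|n IHn] A Apd.
  split=> [||[]//]; first by apply/matrixP => -[].
  by apply/is_trig_mxP => -[].
move: A Apd; rewrite -[n.+1]/(1 + n)%N => A Apd; rewrite (choleskyS A) /=.
have [a [c [S AE]]] : exists a c S, A = block_mx a%:M c^T c S.
  exists (ulsubmx A 0 0), (dlsubmx A), (drsubmx A).
  have -> : (dlsubmx A)^T = ursubmx A by rewrite trmx_dlsub; case: Apd => ->.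
  by rewrite -mx11_scalar submxK.
rewrite AE in Apd *.
rewrite block_mxKul block_mxKdl block_mxKdr.
have [a_gt0 Schur_pd] := posdefmx_schur Apd.
have -> : (a%:M : 'M_1) 0 0 = a by rewrite mxE eqxx.
set d := Num.sqrt a.
have d_neq0 : d != 0 by rewrite sqrtr_eq0 -ltNge.
have d2 : d * d = a by rewrite -expr2 sqr_sqrtr // ltW.
(* As [d * d = a], the matrix passed to the recursive call is exactly the Schur complement. *)
have -> : S - d^-1 *: c *m (d^-1 *: c)^T = S - a^-1 *: (c *m c^T).
  by rewrite linearZ /= -scalemxAl -scalemxAr scalerA -invfM d2.
have [TT Ttrig Tdiag] := IHn _ Schur_pd.
set T := result _ in TT Ttrig Tdiag *; split.
- rewrite tr_block_mx mulmx_block trmx0 !mul0mx !mulmx0 !addr0 TT.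
  rewrite tr_scalar_mx !mul_scalar_mx mul_mx_scalar linearZ /=.
  rewrite !scalerA divff // !scale1r scale_scalar_mx d2.
    rewrite -scalemxAl -scalemxAr scalerA -invfM d2.
  by rewrite addrC subrK.
- by rewrite is_trig_block_mx // eqxx Ttrig mx11_is_trig.
- move=> i; case: (split_ordP i) => j ->; last by rewrite block_mxEdr.
  by rewrite block_mxEul ord1 mxE eqxx.
Qed.

Lemma forward_subst_correct n (T : 'M[R]_n) (b : 'cV_n) :
  is_trig_mx T -> (forall i, T i i != 0) ->
  T *m result (forward_subst T b) = b.
Proof.
elim: n T b => [|n IHn] T b Ttrig Tdiag; first by apply/matrixP => -[].
move: T b Ttrig Tdiag; rewrite -[n.+1]/(1 + n)%N => T b.
rewrite -[T in is_trig_mx T]submxK is_trig_block_mx //.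
case/and3P=> /eqP ur0 _ drtrig Tdiag; rewrite (forward_substS T b) /=.
set y0 := _ / _; set y := result _.
(* The zero upper right block leaves the first equation with [y0] alone; the recursive call solves
   the others after [y0] times the first column is subtracted. *)
rewrite -[T in T *m _]submxK mul_block_col ur0 mul0mx addr0 IHn //; last first.
  by move=> i; have := Tdiag (rshift 1 i); rewrite !mxE.
have T00 : ulsubmx T 0 0 != 0 by have := Tdiag (lshift n 0); rewrite !mxE.
rewrite !mul_mx_scalar subrKC [ulsubmx T]mx11_scalar scale_scalar_mx divfK //.
by rewrite -mx11_scalar vsubmxK.
Qed.

Lemma backward_subst_correct n (T : 'M[R]_n) (y : 'cV_n) :
  is_trig_mx T -> (forall i, T i i != 0) ->
  T^T *m result (backward_subst T y) = y.
Proof.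
elim: n T y => [|n IHn] T y Ttrig Tdiag; first by apply/matrixP => -[].
move: T y Ttrig Tdiag; rewrite -[n.+1]/(1 + n)%N => T y.
rewrite -[T in is_trig_mx T]submxK is_trig_block_mx //.
case/and3P=> /eqP ur0 _ drtrig Tdiag; rewrite (backward_substS T y) /=.
set x := result _; set x0 := _ / _.
(* In [T^T] the zero block lies below the pivot, so the trailing unknowns are determined first. *)
rewrite -[T in T^T *m _]submxK tr_block_mx mul_block_col ur0 trmx0 mul0mx add0r.
rewrite IHn //; last first.
  by move=> i; have := Tdiag (rshift 1 i); rewrite !mxE.
have T00 : ulsubmx T 0 0 != 0 by have := Tdiag (lshift n 0); rewrite !mxE.
rewrite mul_mx_scalar [ulsubmx T]mx11_scalar tr_scalar_mx scale_scalar_mx.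
rewrite divfK // raddfB /= -!mx11_scalar subrK.
by rewrite vsubmxK.
Qed.

Lemma cholesky_solve_correct m r (A : 'M[R]_m) (B : 'M_(m, r)) :
  posdefmx A -> result (cholesky_solve A B) = invmx A *m B.
Proof.
move=> Apd; have Aunit := posdefmx_unit Apd.
have [] := cholesky_correct Apd; set T := result _ => TT Ttrig Tdiag.
apply: (canRL (mulKmx Aunit)); apply/matrixP => i j.
set Z := result _.
(* Each column is solved separately: backward substitution undoes [T^T], forward substitution undoes
   [T]. *)
have /colP/(_ i) : col j (A *m Z) = col j B.
  rewrite colE -mulmxA -colE col_result_c_cols.
  rewrite [X in A *m X]/(result (backward_subst T
    (result (forward_subst T (col j B))))) -[A in A *m _]TT -mulmxA.
  by rewrite backward_subst_correct // forward_subst_correct.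
by rewrite !mxE.
Qed.

End CholeskyCorrectness.

(** * Correctness and cost of the updates and of Nie's iteration *)

Section Updates.
Context {R : rcfType}.

Lemma result_c_div_diag L N (X : 'M[R]_(L, N)) V :
  pos_diag_mx V -> result (c_div_diag X V) = X *m invmx V.
Proof.
move=> Vpos; have Vunit := posdefmx_unit (pos_diag_posdef Vpos).
case: Vpos => /is_diag_mxP Vdiag Vpos.
(* Right multiplication by the diagonal [V] scales column [j] by [V j j], undoing the division. *)
apply: (canRL (mulmxK Vunit)); apply/matrixP => i j.
rewrite mxE (bigD1 j) //= big1 => [|k neq_kj]; last by rewrite Vdiag ?mulr0.
by rewrite mxE /= divfK ?addr0 // gt_eqF.
Qed.

Lemma update_i_correct L N (X P : 'M[R]_(L, N)) V (beta : R) :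
  0 <= beta -> posdefmx V ->
  result (update_i X P V beta) = rule_i X P V beta.
Proof.
move=> beta_ge0 Vpd.
transitivity (result (c_scalemx beta (result (cholesky_solve
  (result (c_addmx V (result (c_scalemx beta (result (c_mulmx X^T X))))))
  (result (c_mulmx X^T P)))))); first by [].
rewrite !(result_c_scalemx, result_c_mulmx, result_c_addmx).
by rewrite (cholesky_solve_correct _ (posdef_sys_i X beta_ge0 Vpd)) mulmxA.
Qed.

Lemma update_ii_correct L N (X P : 'M[R]_(L, N)) V (beta : R) :
  0 <= beta -> pos_diag_mx V ->
  result (update_ii X P V beta) = rule_ii X P V beta.
Proof.
move=> beta_ge0 Vpos; have Vpd := pos_diag_posdef Vpos.
pose B := result (c_scalemx beta (result (c_div_diag X V))^T).
transitivity (result (c_mulmx B (result (cholesky_solve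
  (result (c_addmx 1%:M (result (c_mulmx X B)))) P)))); first by [].
rewrite !(result_c_mulmx, result_c_addmx).
rewrite /B result_c_scalemx result_c_div_diag // -scalemxAr -scalemxAl.
by rewrite (cholesky_solve_correct _ (posdef_sys_ii X beta_ge0 Vpd)) mulmxA.
Qed.

Lemma nops_update_i L N (X P : 'M[R]_(L, N)) V beta :
  nops (update_i X P V beta)
    = (4 * N ^ 2 * L + 3 * N ^ 3 + 3 * N ^ 2 + N)%N.
Proof.
pose S := result (c_addmx V (result (c_scalemx beta (result (c_mulmx X^T X))))).
pose W := result (c_mulmx X^T P).
transitivity (nops (c_mulmx X^T X)
  + (nops (c_scalemx beta (result (c_mulmx X^T X)))
  + (nops (c_addmx V (result (c_scalemx beta (result (c_mulmx X^T X)))))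
  + (nops (c_mulmx X^T P) + (nops (cholesky_solve S W)
  + nops (c_scalemx beta (result (cholesky_solve S W))))))))%N; first by [].
rewrite !(nops_c_scalemx, nops_c_mulmx, nops_c_addmx).
by move: (nops _) (nops_cholesky_solve S W) => t; lia.
Qed.

Lemma nops_update_ii L N (X P : 'M[R]_(L, N)) V beta :
  nops (update_ii X P V beta)
    = (3 * L * N + 4 * L ^ 2 * N + 2 * N ^ 2 * L + L ^ 3 + L)%N.
Proof.
pose Y := result (c_div_diag X V).
pose B := result (c_scalemx beta Y^T).
pose S := result (c_addmx 1%:M (result (c_mulmx X B))).
transitivity (nops (c_div_diag X V) + (nops (c_scalemx beta Y^T)
  + (nops (c_mulmx X B) + (nops (c_addmx 1%:M (result (c_mulmx X B)))
  + (nops (cholesky_solve S P)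
  + nops (c_mulmx B (result (cholesky_solve S P))))))))%N; first by [].
rewrite nops_c_div_diag !(nops_c_scalemx, nops_c_mulmx, nops_c_addmx).
by move: (nops _) (nops_cholesky_solve S P) => t; lia.
Qed.

Lemma update_correct L N (X P : 'M[R]_(L, N)) V (beta : R) :
  0 <= beta -> pos_diag_mx V ->
  result (update X P V beta) =
    (if (N <= L)%N then rule_i X P V beta else rule_ii X P V beta).
Proof.
move=> beta_ge0 Vpos; rewrite /update; case: (leqP N L) => _.
  by rewrite update_i_correct //; apply: pos_diag_posdef.
exact: update_ii_correct.
Qed.

(** In both branches every monomial of the exact count is at most [N^2 L] and the coefficients sum
    to 11, so 12 suffices. *)
Lemma nops_update_le L N (X P : 'M[R]_(L, N)) V beta :
  (0 < L)%N -> (0 < N)%N ->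
  (nops (update X P V beta) <= 12 * (N ^ 2 * L))%N.
Proof.
move=> L_gt0 N_gt0; rewrite /update; case: (leqP N L) => leNL.
  rewrite nops_update_i.
  have : (N ^ 2 * N <= N ^ 2 * L)%N by rewrite leq_mul2l leNL orbT.
  have : (N ^ 2 * 1 <= N ^ 2 * L)%N by rewrite leq_mul2l L_gt0 orbT.
  have : (N * 1 <= N * N)%N by rewrite leq_mul2l N_gt0 orbT.
  by lia.
rewrite nops_update_ii.
have : (N * L * L <= N * L * N)%N by rewrite leq_mul2l (ltnW leNL) orbT.
have : (L * L * L <= N * L * N)%N by rewrite !leq_mul // ltnW.
have : (N * L * 1 <= N * L * N)%N by rewrite leq_mul2l N_gt0 orbT.
have : (1 * L * 1 <= N * L * N)%N by rewrite !leq_mul.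
by lia.
Qed.

(** The loop body of [nie_iteration], with the shared matrices as parameters so that their cost is
    counted once, outside. *)
Definition nie_column L N (X : 'M[R]_(L, N)) (G gV : 'M[R]_N) u n :=
  uG <-- c_scalemx u G;
  S <-- c_addmx uG gV;
  w <-- c_mulmx X^T (col n X);
  z <-- cholesky_solve S w;
  c_scalemx u z.

Lemma nie_iterationE L N (X : 'M[R]_(L, N)) U V' gamma :
  result (nie_iteration X U V' gamma)
    = result (c_cols (fun n => nie_column X (X^T *m X) (gamma *: V') (U n) n))
  /\ nops (nie_iteration X U V' gamma)
    = (N * N * (2 * L) + N * N
      + nops (c_cols (fun n =>
          nie_column X (X^T *m X) (gamma *: V') (U n) n)))%N.
Proof.
rewrite -result_c_mulmx -result_c_scalemx; split=> //.
rewrite -(nops_c_mulmx X^T X) -(nops_c_scalemx gamma V') -addnA.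
by [].
Qed.

Lemma result_nie_column L N (X : 'M[R]_(L, N)) G gV (u : R) n :
  posdefmx (u *: G + gV) ->
  result (nie_column X G gV u n) =
    u *: (invmx (u *: G + gV) *m X^T *m col n X).
Proof.
move=> Spd; transitivity (result (c_scalemx u (result (cholesky_solve
  (result (c_addmx (result (c_scalemx u G)) gV))
  (result (c_mulmx X^T (col n X))))))); first by [].
rewrite !(result_c_scalemx, result_c_mulmx, result_c_addmx).
by rewrite cholesky_solve_correct // mulmxA.
Qed.

Lemma nops_nie_column L N (X : 'M[R]_(L, N)) G gV (u : R) n :
  nops (nie_column X G gV u n)
    = (N ^ 3 + 3 * N ^ 2 + 3 * N + 2 * N * L)%N.
Proof.
pose S := result (c_addmx (result (c_scalemx u G)) gV).
pose w := result (c_mulmx X^T (col n X)).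
transitivity (nops (c_scalemx u G) + (nops (c_addmx (result (c_scalemx u G)) gV)
  + (nops (c_mulmx X^T (col n X)) + (nops (cholesky_solve S w)
  + nops (c_scalemx u (result (cholesky_solve S w)))))))%N; first by [].
rewrite !(nops_c_scalemx, nops_c_mulmx, nops_c_addmx).
by move: (nops _) (nops_cholesky_solve S w) => t; lia.
Qed.

Lemma nie_iteration_correct L N (X : 'M[R]_(L, N)) U V' (gamma : R) n :
  0 < gamma -> (forall n, 0 < U n) -> pos_diag_mx V' ->
  col n (result (nie_iteration X U V' gamma)) = nie_vec X U V' gamma n.
Proof.
move=> gamma_gt0 U_gt0 V'pos; have [-> _] := nie_iterationE X U V' gamma.
rewrite col_result_c_cols result_nie_column // addrC.
(* Here [gamma *: V'] is the definite summand and the Gram matrix the semidefinite one. *)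
apply: posdefmxDZ; first exact/posdefmxZ/pos_diag_posdef.
- exact: ltW.
- exact: trmx_gram.
- exact: gram_form_ge0.
Qed.

Lemma nops_nie_iteration L N (X : 'M[R]_(L, N)) U V' (gamma : R) :
  nops (nie_iteration X U V' gamma)
    = (N ^ 4 + 3 * N ^ 3 + 4 * N ^ 2 + 4 * N ^ 2 * L)%N.
Proof.
have [_ ->] := nie_iterationE X U V' gamma.
rewrite (@nops_c_cols_const _ _ _ _ _ (fun n => nops_nie_column _ _ _ _ n)).
by lia.
Qed.

End Updates.

Theorem corollary3 (R : realType) :
  (* the inverses exist and the two rules give the same matrix *)
  (forall (L N : nat) (X P : 'M[R]_(L, N)) (V : 'M[R]_N) (beta : R),
     0 <= beta -> pos_diag_mx V ->
     [/\ sys_i X V beta \in unitmx,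
         sys_ii X V beta \in unitmx
       & rule_i X P V beta = rule_ii X P V beta]) /\
  (* the algorithm computes the update, in O(N^2 L) operations *)
  (exists C : nat,
     forall (L N : nat) (X P : 'M[R]_(L, N)) (V : 'M[R]_N) (beta : R),
       (0 < L)%N -> (0 < N)%N -> 0 <= beta -> pos_diag_mx V ->
       result (update X P V beta) =
         (if (N <= L)%N then rule_i X P V beta else rule_ii X P V beta) /\
       (nops (update X P V beta) <= C * (N ^ 2 * L))%N) /\
  (* for L <= N, an iteration of Nie's method takes Theta(N^4) operations *)
  (exists C : nat,
     forall (L N : nat) (X : 'M[R]_(L, N)) (U : 'I_N -> R) (V' : 'M[R]_N)
            (gamma : R),
       (0 < L)%N -> (L <= N)%N -> 0 < gamma -> (forall n, 0 < U n) ->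
       pos_diag_mx V' ->
       [/\ forall n, col n (result (nie_iteration X U V' gamma)) =
                     nie_vec X U V' gamma n,
           (nops (nie_iteration X U V' gamma) <= C * N ^ 4)%N
         & (N ^ 4 <= C * nops (nie_iteration X U V' gamma))%N]).
Proof.
split; [|split].
- move=> L N X P V beta beta_ge0 /pos_diag_posdef Vpd; split.
  + exact/posdefmx_unit/posdef_sys_i.
  + exact/posdefmx_unit/posdef_sys_ii.
  + exact: rule_i_ii.
- exists 12 => L N X P V beta L_gt0 N_gt0 beta_ge0 Vpos; split.
  + exact: update_correct.
  + exact: nops_update_le.
(* The coefficients 1, 3, 4, 4 of the exact count sum to 12, and for [0 < L <= N] each monomial is
   at most [N^4]. The lower bound comes from the term [N^4] itself. *)
- exists 12 => L N X U V' gamma L_gt0 leLN gamma_gt0 U_gt0 V'pos; split.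
  + by move=> n; apply: nie_iteration_correct.
  + rewrite nops_nie_iteration.
    have : (N ^ 2 * L <= N ^ 2 * N)%N by rewrite leq_mul2l leLN orbT.
    have : (N ^ 3 * 1 <= N ^ 3 * N)%N.
      by rewrite leq_mul2l (leq_trans L_gt0) ?orbT.
    have : (N ^ 2 * 1 <= N ^ 2 * N)%N.
      by rewrite leq_mul2l (leq_trans L_gt0) ?orbT.
    by lia.
  + by rewrite nops_nie_iteration; lia.
Qed.
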